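(* Let $\varphi=(\varphi_1,\varphi_2)$ be an $\mathbb R^2$-valued function of $(x,y)$ on an open subset of $\mathbb R^2$, differentiable in the usual sense, let $\alpha,\beta\in\mathbb R$, and let $k,l$ be real-valued functions of $(x,y)$. Then the $\varphi\mathbb A$-differentiable functions $(r,s)$ are solutions of the following homogeneous first order linear partial differential equation with dependent variables $r$ and $s$: (1) for $\mathbb A=\mathbb A^2_1(\alpha,\beta)$: $$(k\varphi_{1y}+l\varphi_{2y})r_x+(l\varphi_{1y}+(k\alpha+l\beta)\varphi_{2y})s_x-(k\varphi_{1x}+l\varphi_{2x})r_y-(l\varphi_{1x}+(k\alpha+l\beta)\varphi_{2x})s_y=0;$$ (2) for $\mathbb A=\mathbb A^2_2(\alpha,\beta)$: $$(k\varphi_{2y}+(k\alpha+l\beta)\varphi_{1y})r_x+(k\varphi_{1y}+l\varphi_{2y})s_x-((k\alpha+l\beta)\varphi_{1x}+k\varphi_{2x})r_y-(k\varphi_{1x}+l\varphi_{2x})s_y=0;$$ (3) for $\mathbb A=\mathbb A^2_{1,2}$: $$k\varphi_{1y}r_x+l\varphi_{2y}s_x-k\varphi_{1x}r_y-l\varphi_{2x}s_y=0.$$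
   Context: Subscripts $x,y$ denote partial derivatives. The algebras are $\mathbb R^2$ with canonical basis $e_1,e_2$ and the following commutative, associative, unital bilinear products. $\mathbb A^2_1(\alpha,\beta)$: $e_1e_1=e_1$, $e_1e_2=e_2$, $e_2e_2=\alpha e_1+\beta e_2$. $\mathbb A^2_2(\alpha,\beta)$: $e_1e_1=\alpha e_1+\beta e_2$, $e_1e_2=e_1$, $e_2e_2=e_2$. $\mathbb A^2_{1,2}$: $e_1e_1=e_1$, $e_1e_2=0$, $e_2e_2=e_2$. A function $f=(r,s):U\subset\mathbb R^2\to\mathbb R^2$, differentiable in the usual sense on an open set $U$, is $\varphi\mathbb A$-differentiable if there is a function $f'_\varphi:U\to\mathbb R^2$ such that $df_p(\xi)=f'_\varphi(p)\,d\varphi_p(\xi)$ ($\mathbb A$-product) for all $p\in U$, $\xi\in\mathbb R^2$. *)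

(* Defs.v *)
From HB Require Import structures.
From mathcomp Require Import all_boot all_order all_algebra.
From mathcomp Require Import all_classical all_reals all_analysis.
From mathcomp Require Import ring.
Set Implicit Arguments.
Unset Strict Implicit.
Unset Printing Implicit Defensive.
Import Order.TTheory GRing.Theory Num.Theory.
Import numFieldNormedType.Exports.
Local Open Scope classical_set_scope.
Local Open Scope ring_scope.

Definition e1 {R : realType} : 'rV[R]_2 := delta_mx 0 0.
Definition e2 {R : realType} : 'rV[R]_2 := delta_mx 0 1.

(* A commutative bilinear product on R^2 is determined by e1 e1, e1 e2, e2 e2. *)
Record alg_table (R : realType) := AlgTable {
  e1e1 : 'rV[R]_2 ;
  e1e2 : 'rV[R]_2 ;
  e2e2 : 'rV[R]_2 }.

Definition alg_mul (R : realType) (A : alg_table R) (u v : 'rV[R]_2) : 'rV[R]_2 :=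
  (u 0 0 * v 0 0) *: e1e1 A
  + (u 0 0 * v 0 1 + u 0 1 * v 0 0) *: e1e2 A
  + (u 0 1 * v 0 1) *: e2e2 A.

Definition A21 (R : realType) (alpha beta : R) : alg_table R :=
  AlgTable e1 e2 (alpha *: e1 + beta *: e2).

Definition A22 (R : realType) (alpha beta : R) : alg_table R :=
  AlgTable (alpha *: e1 + beta *: e2) e1 e2.

Definition A212 (R : realType) : alg_table R := AlgTable e1 0 e2.

Definition comm_assoc_unital (R : realType) (A : alg_table R) (e : 'rV[R]_2) : Prop :=
  [/\ commutative (alg_mul A), associative (alg_mul A) & left_id e (alg_mul A)].

Lemma eq_rV2 (R : realType) (u v : 'rV[R]_2) :
  u 0 0 = v 0 0 -> u 0 1 = v 0 1 -> u = v.
Proof.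
move=> h0 h1; apply/rowP => -[[|[|//]] hi].
  by rewrite (_ : Ordinal hi = 0) //; apply: val_inj.
by rewrite (_ : Ordinal hi = 1) //; apply: val_inj.
Qed.

Lemma alg_mul_basis (R : realType) (A : alg_table R) :
  [/\ alg_mul A e1 e1 = e1e1 A, alg_mul A e1 e2 = e1e2 A,
      alg_mul A e2 e1 = e1e2 A & alg_mul A e2 e2 = e2e2 A].
Proof. by split; apply: eq_rV2; rewrite /alg_mul /e1 /e2 !mxE /=; ring. Qed.

Lemma A21_assoc_unital (R : realType) (alpha beta : R) :
  comm_assoc_unital (A21 alpha beta) (e1).
Proof.
by split=> [u v|u v w|u]; apply: eq_rV2;
  rewrite /alg_mul /e1 /e2 !mxE /=; ring.
Qed.

Lemma A22_assoc_unital (R : realType) (alpha beta : R) :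
  comm_assoc_unital (A22 alpha beta) (e2).
Proof.
by split=> [u v|u v w|u]; apply: eq_rV2;
  rewrite /alg_mul /e1 /e2 !mxE /=; ring.
Qed.

Lemma A212_assoc_unital (R : realType) :
  comm_assoc_unital (A212 R) (e1 + e2).
Proof.
by split=> [u v|u v w|u]; apply: eq_rV2;
  rewrite /alg_mul /e1 /e2 !mxE /=; ring.
Qed.

(* Functions on an open set are represented by total functions; only their
   values on that open set matter below. *)
Definition phiA_differentiable (R : realType) (A : alg_table R)
    (phi : 'rV[R]_2 -> 'rV[R]_2) (U : set 'rV[R]_2)
    (f : 'rV[R]_2 -> 'rV[R]_2) : Prop :=
  (forall p, U p -> differentiable f p) /\
  exists f' : 'rV[R]_2 -> 'rV[R]_2, forall p, U p -> forall xi : 'rV[R]_2,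
    'd f p xi = alg_mul A (f' p) ('d phi p xi).

Definition fst_comp (R : realType) (f : 'rV[R]_2 -> 'rV[R]_2) : 'rV[R]_2 -> R :=
  fun p => f p 0 0.
Definition snd_comp (R : realType) (f : 'rV[R]_2 -> 'rV[R]_2) : 'rV[R]_2 -> R :=
  fun p => f p 0 1.

Definition partial_x (R : realType) (g : 'rV[R]_2 -> R) (p : 'rV[R]_2) : R :=
  'D_e1 g p.
Definition partial_y (R : realType) (g : 'rV[R]_2 -> R) (p : 'rV[R]_2) : R :=
  'D_e2 g p.

Definition has_partials (R : realType) (g : 'rV[R]_2 -> R) (p : 'rV[R]_2) : Prop :=
  derivable g p e1 /\ derivable g p e2.

(* The pair (r, s) solves  a r_x + b s_x - c r_y - d s_y = 0  on U; the
   existence of the partials is required since 'D_v is total. *)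
Definition solves_pde (R : realType) (U : set 'rV[R]_2)
    (a b c d : 'rV[R]_2 -> R) (r s : 'rV[R]_2 -> R) : Prop :=
  forall p, U p ->
    [/\ has_partials r p, has_partials s p &
        a p * partial_x r p + b p * partial_x s p
        - c p * partial_y r p - d p * partial_y s p = 0].

(* Main.v *)
(** Commutativity and associativity turn [df_p(u) = f'(p) dphi_p(u)] into
    [dphi_p(v) df_p(u) = dphi_p(u) df_p(v)], from which the unknown [f'] has
    disappeared.  For [u = e1], [v = e2], pairing this identity of vectors with
    the covector [(k, l)] gives the PDE of each algebra. *)
Require Import Defs.
From HB Require Import structures.
From mathcomp Require Import all_boot all_order all_algebra.
From mathcomp Require Import all_classical all_reals all_analysis.
From mathcomp Require Import ring.
Set Implicit Arguments.
Unset Strict Implicit.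
Unset Printing Implicit Defensive.
Import Order.TTheory GRing.Theory Num.Theory.
Import numFieldNormedType.Exports.
Local Open Scope classical_set_scope.
Local Open Scope ring_scope.

Lemma has_partials_coord (R : realType) (f : 'rV[R]_2 -> 'rV[R]_2) p (j : 'I_2) :
  differentiable f p -> has_partials (fun q => f q 0 j) p.
Proof.
by move=> df; split; apply: (derivable_mxP f p _).1; exact: diff_derivable.
Qed.

(** At [v = e1] and [v = e2] this is the bridge between differentials, where the algebra acts, and
    the partials in the PDE. *)
Lemma diffE_coord (R : realType) (f : 'rV[R]_2 -> 'rV[R]_2) (p v : 'rV[R]_2) :
  differentiable f p ->
  'd f p v = 'D_v (fst_comp f) p *: e1 + 'D_v (snd_comp f) p *: e2.
Proof.
move=> df; rewrite -deriveE // derive_mx; last exact: diff_derivable.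
by apply: eq_rV2; rewrite !mxE /= !Monoid.simpm.
Qed.

Lemma phiA_differentiable_exchange (R : realType) (A : alg_table R) (e : 'rV[R]_2)
    (phi : 'rV[R]_2 -> 'rV[R]_2) (U : set 'rV[R]_2) (f : 'rV[R]_2 -> 'rV[R]_2)
    (p u v : 'rV[R]_2) :
    comm_assoc_unital A e -> phiA_differentiable A phi U f -> U p ->
  alg_mul A ('d phi p v) ('d f p u) = alg_mul A ('d phi p u) ('d f p v).
Proof.
move=> [mulC mulA _] [_ [f' f'E]] Up.
(* With [a = f' p], [x] and [y] the values of ['d phi p] at [u] and [v], both sides of the goal are
   the same triple product. *)
have mulCA a x y : alg_mul A y (alg_mul A a x) = alg_mul A x (alg_mul A a y).
  by rewrite !mulA (mulC y a) (mulC x a) -!mulA (mulC y x).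
apply: etrans (congr1 (alg_mul A ('d phi p v)) (f'E p Up u)) _.
apply: etrans (mulCA _ _ _) _.
exact: (esym (congr1 (alg_mul A ('d phi p u)) (f'E p Up v))).
Qed.

(** Isolates what depends on the algebra: [(a, b)] and [(c, d)] must be the covector [(k, l)] pulled
    back along multiplication by ['d phi p e2] and ['d phi p e1]. *)
Lemma phiA_differentiable_pairing (R : realType) (A : alg_table R) (e : 'rV[R]_2)
    (phi : 'rV[R]_2 -> 'rV[R]_2) (U : set 'rV[R]_2) (f : 'rV[R]_2 -> 'rV[R]_2)
    (p : 'rV[R]_2) (k l a b c d : R) :
    comm_assoc_unital A e -> phiA_differentiable A phi U f -> U p ->
    differentiable phi p ->
    (forall r s,
      let w := alg_mul A (partial_y (fst_comp phi) p *: e1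
                          + partial_y (snd_comp phi) p *: e2) (r *: e1 + s *: e2) in
      a * r + b * s = k * w 0 0 + l * w 0 1) ->
    (forall r s,
      let w := alg_mul A (partial_x (fst_comp phi) p *: e1
                          + partial_x (snd_comp phi) p *: e2) (r *: e1 + s *: e2) in
      c * r + d * s = k * w 0 0 + l * w 0 1) ->
  [/\ has_partials (fst_comp f) p, has_partials (snd_comp f) p &
      a * partial_x (fst_comp f) p + b * partial_x (snd_comp f) p
      - c * partial_y (fst_comp f) p - d * partial_y (snd_comp f) p = 0].
Proof.
move=> HA Hf Up dphi Hx Hy; have df := Hf.1 _ Up.
split; [exact: has_partials_coord|exact: has_partials_coord|].
(* Grouped as x-terms minus y-terms, the left side becomes [(k, l)] paired with the two sides of the
   exchange identity. *)
rewrite -addrA -opprD Hx Hy -!diffE_coord //.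
by rewrite (phiA_differentiable_exchange e1 e2 HA Hf Up) subrr.
Qed.

Theorem theorem4p1 (R : realType) (V : set 'rV[R]_2)
    (phi : 'rV[R]_2 -> 'rV[R]_2) (alpha beta : R) (k l : 'rV[R]_2 -> R)
    (V_open : open V) (phi_diff : forall p, V p -> differentiable phi p) :
  let phi1x := partial_x (fst_comp phi) in
  let phi1y := partial_y (fst_comp phi) in
  let phi2x := partial_x (snd_comp phi) in
  let phi2y := partial_y (snd_comp phi) in
  forall (U : set 'rV[R]_2) (f : 'rV[R]_2 -> 'rV[R]_2),
  open U -> U `<=` V ->
  [/\ phiA_differentiable (A21 alpha beta) phi U f ->
      solves_pde U
        (fun p => k p * phi1y p + l p * phi2y p)
        (fun p => l p * phi1y p + (k p * alpha + l p * beta) * phi2y p)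
        (fun p => k p * phi1x p + l p * phi2x p)
        (fun p => l p * phi1x p + (k p * alpha + l p * beta) * phi2x p)
        (fst_comp f) (snd_comp f),
      phiA_differentiable (A22 alpha beta) phi U f ->
      solves_pde U
        (fun p => k p * phi2y p + (k p * alpha + l p * beta) * phi1y p)
        (fun p => k p * phi1y p + l p * phi2y p)
        (fun p => (k p * alpha + l p * beta) * phi1x p + k p * phi2x p)
        (fun p => k p * phi1x p + l p * phi2x p)
        (fst_comp f) (snd_comp f) &
      phiA_differentiable (A212 R) phi U f ->
      solves_pde U
        (fun p => k p * phi1y p)
        (fun p => l p * phi2y p)
        (fun p => k p * phi1x p)
        (fun p => l p * phi2x p)
        (fst_comp f) (snd_comp f)].
Proof.
move=> phi1x phi1y phi2x phi2y U f _ UV.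
split=> Hf p Up; have dphi := phi_diff _ (UV _ Up).
(* The factor [k p * alpha + l p * beta] is [(k, l)] paired with [e2 e2], so it multiplies the
   second component of [phi] and lands on [s]. *)
- apply: (phiA_differentiable_pairing (k := k p) (l := l p)
    (A21_assoc_unital alpha beta) Hf Up dphi) => r s;
  by rewrite /alg_mul !mxE /= -/(phi1x p) -/(phi1y p) -/(phi2x p) -/(phi2y p); ring.
(* Here that factor comes from [e1 e1], hence goes with the first component of [phi] and with
   [r]. *)
- apply: (phiA_differentiable_pairing (k := k p) (l := l p)
    (A22_assoc_unital alpha beta) Hf Up dphi) => r s;
  by rewrite /alg_mul !mxE /= -/(phi1x p) -/(phi1y p) -/(phi2x p) -/(phi2y p); ring.
(* The product is componentwise, so no cross terms survive. *)
- apply: (phiA_differentiable_pairing (k := k p) (l := l p)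
    (A212_assoc_unital R) Hf Up dphi) => r s;
  by rewrite /alg_mul !mxE /= -/(phi1x p) -/(phi1y p) -/(phi2x p) -/(phi2y p); ring.
Qed.
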